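(* Let $G$ be a graph of order $n\ge 6$. If $\Delta(G)\ge n-\pi(n)+\pi(\lfloor n/2\rfloor)-1$, then $G$ is neighborhood-prime.
   Context: All graphs are finite and simple; $[n]=\{1,\dots,n\}$; $N(v)$ is the set of neighbors of $v$. A neighborhood-prime labeling of a graph $G$ of order $n$ is a bijection $f:V(G)\to[n]$ such that for every vertex $v$ of degree greater than $1$, $\gcd\{f(u):u\in N(v)\}=1$; a graph is neighborhood-prime if it has such a labeling. $\Delta(G)$ is the maximum degree of $G$, and $\pi(x)$ is the number of primes less than or equal to $x$. *)

(* Defs.v *)
From mathcomp Require Import all_boot.

Set Implicit Arguments.
Unset Strict Implicit.
Unset Printing Implicit Defensive.

(* A finite simple graph is a finType of vertices together with an irreflexive
   symmetric adjacency relation on it. *)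
Definition simple_graph (V : finType) (e : rel V) : Prop :=
  irreflexive e /\ symmetric e.

Definition neighbors (V : finType) (e : rel V) (v : V) : {set V} :=
  [set u | e v u].

Definition deg (V : finType) (e : rel V) (v : V) : nat := #|neighbors e v|.

Definition max_degree (V : finType) (e : rel V) : nat := \max_(v : V) deg e v.

Definition prime_pi (x : nat) : nat := count prime (iota 1 x).

(* The first two clauses say that f is a bijection from V onto {1, ..., #|V|}.
   Since 0 is neutral for gcdn, the big operator is the gcd of the labels of
   the neighbors of v. *)
Definition neighborhood_prime_labeling (V : finType) (e : rel V)
    (f : V -> nat) : Prop :=
  [/\ injective f,
      forall k : nat, (exists v, f v = k) <-> 1 <= k <= #|V|
    & forall v : V, 1 < deg e v ->
        \big[gcdn/0]_(u in neighbors e v) f u = 1].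

Definition neighborhood_prime (V : finType) (e : rel V) : Prop :=
  exists f : V -> nat, neighborhood_prime_labeling e f.

(* Main.v *)
Require Import Defs.
From mathcomp Require Import all_boot zify.

(** Let [x] be a vertex of maximum degree and label it 1; then every neighbor
    of [x] sees the label 1.  The remaining vertices are the at most
    q + 1 non-neighbors of [x], where q is the number of primes in (n/2, n]
    and [x] itself is counted among them.  A prime of that range has no other
    multiple in [1, n], so it is coprime to every other label, and a vertex of
    degree greater than 1 is satisfied as soon as one of its neighbors carries
    such a large prime ([large_prime_coprime], [gcd_labels_eq1]).  The q large
    primes suffice to give one to a chosen neighbor of each non-neighbor of [x]
    other than [x].

    It remains to satisfy [x].  If a chosen vertex is adjacent to [x], or if a
    large prime is left over for a neighbor of [x], the same argument applies.
    Otherwise the chosen vertices are q non-neighbors of [x], hence all of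
    them, and every label other than 1 and the large primes falls on a neighbor
    of [x] ([large_prime_placement]).  As n is at least 6, these labels include
    2 and 3, which are coprime. *)

Definition large_primes (n : nat) : seq nat :=
  [seq p <- iota 1 n | prime p && (n < p.*2)].

Lemma mem_large_primes n p :
  (p \in large_primes n) = [&& prime p, n < p.*2 & p <= n].
Proof.
rewrite mem_filter mem_iota add1n ltnS -andbA.
by case: (boolP (prime p)) => // /prime_gt0 ->.
Qed.

Lemma prime_pi_large_primes n :
  prime_pi n = prime_pi (n %/ 2) + size (large_primes n).
Proof.
have le_half : n %/ 2 <= n by rewrite leq_div.
rewrite /prime_pi /large_primes size_filter.
have -> : iota 1 n = iota 1 (n %/ 2) ++ iota (1 + n %/ 2) (n - n %/ 2).
  by rewrite -iotaD subnKC.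
rewrite !count_cat.
have -> : count (fun p => prime p && (n < p.*2)) (iota 1 (n %/ 2)) = 0.
  apply/eqP; rewrite -leqn0 leqNgt -has_count; apply/hasPn => p.
  by rewrite mem_iota => p_le; apply/negP => /andP[_]; lia.
rewrite add0n; congr (_ + _); apply: eq_in_count => p.
by rewrite mem_iota => p_ge; rewrite (_ : n < p.*2) ?andbT //; lia.
Qed.

(** A positive multiple of [p] other than [p] is at least [2p], which exceeds [n]. *)
Lemma large_prime_coprime n p a :
  p \in large_primes n -> 0 < a <= n -> a != p -> coprime p a.
Proof.
rewrite mem_large_primes => /and3P[p_prime p_large _] a_le a_neq_p.
rewrite prime_coprime //; apply/negP => /dvdnP[k def_a].
by case: k def_a => [|[|k]]; nia.
Qed.

Lemma biggcdn_eq1 (I : finType) (A : {set I}) (f : I -> nat) i j :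
  i \in A -> j \in A -> coprime (f i) (f j) -> \big[gcdn/0]_(k in A) f k = 1.
Proof.
move=> iA jA /eqP gcd_ij; apply/eqP; rewrite -dvdn1 -gcd_ij dvdn_gcd.
by rewrite (biggcdn_inf i) // (biggcdn_inf j).
Qed.

(** A second label in [A] exists and is coprime to the large prime [f u]. *)
Lemma gcd_labels_eq1 (V : finType) (A : {set V}) (f : V -> nat) n u :
    injective f -> (forall v, 0 < f v <= n) -> 1 < #|A| ->
    u \in A -> f u \in large_primes n ->
  \big[gcdn/0]_(v in A) f v = 1.
Proof.
move=> f_inj f_range A_gt1 uA fu_large.
have /set0Pn[v] : A :\ u != set0.
  by rewrite -card_gt0; move: A_gt1; rewrite (cardsD1 u A) uA.
rewrite !inE => /andP[v_neq_u vA].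
apply: (biggcdn_eq1 _ _ _ u v) => //.
by apply: large_prime_coprime fu_large (f_range v) _; rewrite (inj_eq f_inj).
Qed.

(** List [x], then [C], then the other vertices, and list the labels 1, then
    [P], then the others: matching the two lists position by position gives
    the required bijection. *)
Lemma exists_labeling (V : finType) (x : V) (C : {set V}) (P : seq nat) :
    x \notin C -> uniq P -> {subset P <= iota 2 #|V|.-1} -> #|C| <= size P ->
  exists f : V -> nat,
    [/\ injective f, forall k, (exists v, f v = k) <-> 1 <= k <= #|V|,
        f x = 1 & {in C, forall v, f v \in P}].
Proof.
move=> xC P_uniq P_sub C_le.
have V_gt0 : 0 < #|V| by apply/card_gt0P; exists x.
pose vs := x :: enum C ++ enum (~: (x |: C)).
pose ls := 1 :: P ++ [seq k <- iota 2 #|V|.-1 | k \notin P].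
have vs_mem v : v \in vs.
  by rewrite inE mem_cat !mem_enum !inE; case: eqP => //= _; case: (v \in C).
have vs_uniq : uniq vs.
  rewrite /= mem_cat !mem_enum !inE eqxx (negPf xC) /= cat_uniq !enum_uniq /=.
  rewrite andbT; apply/hasPn => v; rewrite !mem_enum !inE negb_or.
  by case/andP.
have ls_mem k : (k \in ls) = (1 <= k <= #|V|).
  rewrite inE mem_cat mem_filter.
  case: (boolP (k \in P)) => [/P_sub|_] /=; rewrite mem_iota;
    by move: #|V| V_gt0 => N; lia.
have ls_uniq : uniq ls.
  have one_notin : 1 \notin iota 2 #|V|.-1 by rewrite mem_iota.
  rewrite /= mem_cat mem_filter (negPf one_notin) andbF orbF.
  rewrite (contra (P_sub 1) one_notin) /= cat_uniq P_uniq filter_uniq ?iota_uniq //.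
  by rewrite andbT; apply/hasPn => k; rewrite mem_filter => /andP[].
have vs_size : size vs = #|V|.
  by rewrite -(card_uniqP vs_uniq); apply: eq_card => v; rewrite vs_mem.
have ls_size : size ls = #|V|.
  rewrite -(size_iota 1 #|V|); apply: perm_size; apply: uniq_perm => //.
    exact: iota_uniq.
  by move=> k; rewrite ls_mem mem_iota add1n.
have idx_lt v : index v vs < size ls by rewrite ls_size -vs_size index_mem.
exists (fun v => nth 0 ls (index v vs)); split.
- move=> u v /eqP; rewrite nth_uniq // => /eqP eq_idx.
  by rewrite -(nth_index x (vs_mem u)) eq_idx nth_index.
- move=> k; rewrite -ls_mem; split=> [[v <-]|k_ls]; first exact: mem_nth.
  exists (nth x vs (index k ls)).
  by rewrite index_uniq ?nth_index // vs_size -ls_size index_mem.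
- by rewrite /= eqxx.
- move=> v vC; have v_neq_x : x != v by apply: contra xC => /eqP->.
  have idx_v : index v (enum C) < size P.
    by apply: leq_trans C_le; rewrite cardE index_mem mem_enum.
  by rewrite /= (negPf v_neq_x) index_cat mem_enum vC /= nth_cat idx_v mem_nth.
Qed.

(** The set [C] is where large primes will go.  The last alternative is the
    tight case, in which all [q] of them are spent on non-neighbors of [x]. *)
Lemma large_prime_placement (V : finType) (e : rel V) (x : V) (q : nat) :
    simple_graph e -> #|V| <= deg e x + q.+1 ->
  exists C : {set V},
    [/\ x \notin C, #|C| <= q,
        forall v, v != x -> ~~ e x v -> 1 < deg e v ->
          exists2 u, u \in neighbors e v & u \in C
      & 1 < deg e x -> (exists2 u, u \in neighbors e x & u \in C)
          \/ (forall u, u != x -> u \notin C -> u \in neighbors e x)].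
Proof.
case=> e_irr e_sym deg_x.
pose g v := odflt v [pick u in neighbors e v].
have gP v : 1 < deg e v -> g v \in neighbors e v.
  rewrite /g /deg; case: pickP => [//|no_nb].
  by rewrite (eq_card0 no_nb).
pose W := ~: (x |: neighbors e x).
have W_le : #|W| <= q.
  move: deg_x; rewrite -(cardsC (x |: neighbors e x)) cardsU1 inE e_irr /= -/W.
  by rewrite -/(deg e x) add1n addSn addnS ltnS leq_add2l.
pose C := g @: [set v in W | 1 < deg e v].
have C_le : #|C| <= #|W|.
  apply: leq_trans (leq_imset_card _ _) (subset_leq_card _).
  by apply/subsetP => v; rewrite inE => /andP[].
have xC : x \notin C.
  apply/imsetP => -[v]; rewrite !inE negb_or => /andP[/andP[_ xv] /gP].
  by rewrite inE => /[swap] <-; rewrite e_sym (negPf xv).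
have C_hits v : v != x -> ~~ e x v -> 1 < deg e v ->
    exists2 u, u \in neighbors e v & u \in C.
  move=> v_x xv v_gt1; exists (g v); first exact: gP.
  by apply: imset_f; rewrite !inE negb_or v_x xv.
(* When a large prime is left over, it goes to a neighbor of [x]. *)
have [C_lt|C_ge] := ltnP #|C| q.
  case: (leqP (deg e x) 1) => [x_le1|x_gt1].
    by exists C; split=> //; exact: ltnW.
  have gx := gP x x_gt1; exists (g x |: C); split.
  - rewrite !inE negb_or xC andbT; apply: contraTneq gx => <-.
    by rewrite inE e_irr.
  - by rewrite cardsU1; case: (_ \notin _) => //=; lia.
  - move=> v v_x xv v_gt1; have [u nu uC] := C_hits v v_x xv v_gt1.
    by exists u; rewrite ?in_setU1 ?uC ?orbT.
  - by left; exists (g x); rewrite ?setU11.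
exists C; split=> //; first exact: leq_trans W_le.
move=> _; have [/exists_inP|] := boolP [exists (u | u \in neighbors e x), u \in C].
  by left.
rewrite negb_exists_in => /forall_inP no_hit; right.
have sCW : C \subset W.
  apply/subsetP => u uC; rewrite inE in_setU1 negb_or.
  apply/andP; split; first by apply: contraNneq xC => <-.
  by apply: contraL uC => /no_hit.
have eqCW : C = W by apply/eqP; rewrite eqEcard sCW (leq_trans W_le C_ge).
by move=> u u_x; rewrite eqCW inE in_setU1 (negPf u_x) negbK.
Qed.

Theorem proposition20 (V : finType) (e : rel V) (n : nat)
    (hG : simple_graph e) (hcard : #|V| = n) (hn : 6 <= n)
    (hdeg : n - prime_pi n + prime_pi (n %/ 2) - 1 <= max_degree e) :
  neighborhood_prime e.
Proof.
have [_ e_sym] := hG.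
have V_gt0 : 0 < #|V| by lia.
have [x def_max] := bigop.eq_bigmax (deg e) V_gt0.
set P := large_primes n.
have deg_x : #|V| <= deg e x + (size P).+1.
  (* This keeps the truncated subtraction in [hdeg] faithful. *)
  have pi_le : prime_pi n <= n by rewrite (leq_trans (count_size _ _)) ?size_iota.
  move: hdeg pi_le; rewrite prime_pi_large_primes /max_degree def_max -/P hcard.
  by move: (prime_pi _) (size P) (deg e x) => h q d; lia.
have [C [xC C_le C_hits C_x]] := large_prime_placement V e x (size P) hG deg_x.
have P_sub : {subset P <= iota 2 #|V|.-1}.
  move=> p; rewrite mem_large_primes mem_iota => /and3P[/prime_gt1]; lia.
have [|f [f_inj f_im fx fC]] := exists_labeling V x C P xC _ P_sub C_le.
  by rewrite filter_uniq ?iota_uniq.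
have f_range v : 0 < f v <= n by rewrite -hcard; apply/f_im; exists v.
have hit v : 1 < deg e v -> (exists2 u, u \in neighbors e v & u \in C) ->
    \big[gcdn/0]_(u in neighbors e v) f u = 1.
  by move=> v_gt1 [u nu /fC]; apply: gcd_labels_eq1 nu.
exists f; split=> // v v_gt1.
have [xv|xv] := boolP (e x v).
  apply: (biggcdn_eq1 _ _ _ x x); rewrite ?inE 1?e_sym //.
  by rewrite fx.
have [v_x|v_x] := eqVneq v x; last exact/hit/C_hits.
rewrite {v xv}v_x in v_gt1 *.
have [x_hit|rest_nb] := C_x v_gt1; first exact: hit.
have small_nb k : 1 < k <= 3 -> exists2 u, u \in neighbors e x & f u = k.
  move=> k_le; have [u fu] : exists u, f u = k by apply/f_im; lia.
  exists u => //; apply: rest_nb.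
    by apply: contraTneq k_le => u_x; rewrite -fu u_x fx.
  by apply/negP => /fC; rewrite fu mem_large_primes => /and3P[]; lia.
have [u nu fu] := small_nb 2 isT; have [w nw fw] := small_nb 3 isT.
by apply: (biggcdn_eq1 _ _ _ u w); rewrite ?fu ?fw.
Qed.
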